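(* $n(12,7) \leq 2890$; that is, there exists a $12$-regular graph of girth exactly $7$ with at most $2890$ vertices.
   Context: Graphs are finite and simple. For integers $k\ge 2$, $g\ge 3$, a $(k,g)$-graph is a $k$-regular graph with girth $g$ (the length of a shortest cycle is exactly $g$). $n(k,g)$ denotes the smallest possible number of vertices of a $(k,g)$-graph. *)

(* Defs.v *)
From mathcomp Require Import all_boot.

Set Implicit Arguments.
Unset Strict Implicit.
Unset Printing Implicit Defensive.

(* Finite simple graphs. *)
Record sgraph := SGraph {
  vertex :> finType;
  adj : rel vertex;
  adj_sym : symmetric adj;
  adj_irrefl : irreflexive adj
}.

Definition regular (k : nat) (G : sgraph) : Prop :=
  forall x : G, #|[set y : G | adj x y]| = k.

(* The bound 3 <= size c is needed because ucycle accepts the empty sequence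
   and, adj being symmetric, the closed walk [:: x; y] along an edge. *)
Definition is_cycle (G : sgraph) (c : seq G) : Prop :=
  3 <= size c /\ ucycle (@adj G) c.

(* The girth of G exists and equals g; in particular G is not a forest. *)
Definition has_girth (g : nat) (G : sgraph) : Prop :=
  (exists c : seq G, is_cycle c /\ size c = g) /\
  (forall c : seq G, is_cycle c -> g <= size c).

Definition kg_graph (k g : nat) (G : sgraph) : Prop :=
  regular k G /\ has_girth g G.

(* is_n k g m reads n(k,g) = m. It is a relation, so that no default value
   is attached to pairs (k, g) for which no (k,g)-graph has been exhibited. *)
Definition is_n (k g m : nat) : Prop :=
  (exists G : sgraph, kg_graph k g G /\ #|G| = m) /\
  (forall G : sgraph, kg_graph k g G -> m <= #|G|).

(* Main.v *)
(** In the incidence graph of a generalized quadrangle of order q (girth 8, here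
    the symplectic quadrangle, q = 11) take two opposite lines x and y and delete
    them together with the q + 1 paths of length 4 joining them, 3q + 5 vertices
    in all. A deleted vertex other than x and y has q - 1 remaining neighbours,
    which have degree q and are pairwise at distance at least 6; as q - 1 is even,
    perfect matchings on these classes restore regularity. Each class is a copy of
    the nonzero scalars; one involution nu of F serves for the points and for half
    of the matched lines, negation for the other half. A cycle with at most one
    new edge has length at least 7 because the quadrangle has no triangles; with
    two new edges the only dangerous cycles are hexagons in which these are
    opposite, and they are excluded by nu x <> - x and nu (- nu x) <> - x. The
    choice of nu uses that -1 is not a square in F_11. *)
Require Import Defs.
From mathcomp Require Import all_boot.
From mathcomp Require Import all_algebra ring.
From Stdlib Require Import Classical.

Set Implicit Arguments.
Unset Strict Implicit.
Unset Printing Implicit Defensive.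

Import GRing.Theory.
Local Open Scope ring_scope.

(** * Short cycles as words in incidence and matching edges *)

Section GirthFromPatterns.

(* [I] stands for incidence edges and [M] for matching edges. *)
Variables (T : eqType) (side : T -> bool) (I M : rel T).

Hypothesis M_sym : symmetric M.
Hypothesis I_side : forall v w, I v w -> side w = ~~ side v.
Hypothesis M_side : forall v w, M v w -> side w = side v.
Hypothesis M_functional : forall u v w, M u v -> M u w -> v = w.
Hypothesis no_IIII : forall v1 v2 v3 v4, uniq [:: v1; v2; v3; v4] ->
  I v1 v2 -> I v2 v3 -> I v3 v4 -> I v4 v1 -> False.
Hypothesis no_IIIIII : forall v1 v2 v3 v4 v5 v6,
  uniq [:: v1; v2; v3; v4; v5; v6] ->
  I v1 v2 -> I v2 v3 -> I v3 v4 -> I v4 v5 -> I v5 v6 -> I v6 v1 -> False.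
Hypothesis no_MII : forall v1 v2 v3, M v1 v2 -> I v2 v3 -> I v3 v1 -> False.
Hypothesis no_MIM : forall v1 v2 v3 v4, M v1 v2 -> I v2 v3 -> M v3 v4 -> False.
Hypothesis no_MIIII : forall v1 v2 v3 v4 v5,
  M v1 v2 -> I v2 v3 -> I v3 v4 -> I v4 v5 -> I v5 v1 -> False.
Hypothesis no_MIIMII : forall v1 v2 v3 v4 v5 v6, v2 != v4 ->
  M v1 v2 -> I v2 v3 -> I v3 v4 -> M v4 v5 -> I v5 v6 -> I v6 v1 -> False.

Lemma no_MM u v w : u != w -> M u v -> M v w -> False.
Proof.
by rewrite M_sym => /eqP uw vu vw; apply: uw; apply: M_functional vu vw.
Qed.

Ltac parity_clash :=
  repeat match goal with
  | h : is_true (I ?v ?w) |- _ => move: (I_side h) => {}h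
  | h : is_true (M ?v ?w) |- _ => move: (M_side h) => {}h
  end;
  repeat match goal with
  | h : side ?v = _ |- _ => move: h
  end;
  repeat match goal with |- context [side ?v] => case: (side v) end;
  by [].

Ltac forbidden_pattern :=
  match goal with
  | h : is_true (M ?u ?v), h' : is_true (M ?v ?w) |- _ =>
      solve [apply: (no_MM _ h h'); assumption]
  | h : is_true (M _ ?v), h' : is_true (I ?v ?w), h'' : is_true (M ?w _) |- _ =>
      exact: (no_MIM h h' h'')
  | h1 : is_true (M ?a ?b), h2 : is_true (I ?b ?c), h3 : is_true (I ?c ?a) |- _ =>
      exact: (no_MII h1 h2 h3)
  | h1 : is_true (M ?a ?b), h2 : is_true (I ?b ?c), h3 : is_true (I ?c ?d),
    h4 : is_true (I ?d ?e), h5 : is_true (I ?e ?a) |- _ =>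
      exact: (no_MIIII h1 h2 h3 h4 h5)
  | h1 : is_true (M ?a ?b), h2 : is_true (I ?b ?c), h3 : is_true (I ?c ?d),
    h4 : is_true (M ?d ?e), h5 : is_true (I ?e ?f), h6 : is_true (I ?f ?a) |- _ =>
      apply: (no_MIIMII _ h1 h2 h3 h4 h5 h6); assumption
  | h1 : is_true (I ?a ?b), h2 : is_true (I ?b ?c), h3 : is_true (I ?c ?d),
    h4 : is_true (I ?d ?a), hu : is_true (uniq [:: ?a; _; _; _]) |- _ =>
      exact: (no_IIII hu h1 h2 h3 h4)
  | h1 : is_true (I ?a ?b), h2 : is_true (I ?b ?c), h3 : is_true (I ?c ?d),
    h4 : is_true (I ?d ?e), h5 : is_true (I ?e ?f), h6 : is_true (I ?f ?a),
    hu : is_true (uniq [:: ?a; _; _; _; _; _]) |- _ =>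
      exact: (no_IIIIII hu h1 h2 h3 h4 h5 h6)
  | _ => parity_clash
  end.

Ltac split_edges :=
  repeat match goal with
  | |- is_true (_ && _) -> _ => case/andP
  | |- is_true (_ || _) -> _ => case/orP
  | |- is_true true -> _ => move=> _
  | |- _ -> _ => let h := fresh "edge" in move=> h
  end.

(** Each inequality is kept in both orientations, since a pattern may be found at any rotation of
    the cycle. *)
Ltac distinctness hu :=
  move: (hu); rewrite /= !inE !negb_or -!andbA;
  repeat match goal with
  | |- is_true (_ && _) -> _ => case/andP
  | |- is_true true -> _ => move=> _
  | |- is_true (?x != ?y) -> _ =>
      let h := fresh "ne" in move=> h;
      let h' := fresh "ne" in have h' : y != x by rewrite eq_sym
  end.

(** Closing up requires an even number of [I] edges, and [MM] and [MIM] cannot occur. Up to rotation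
    this leaves the words [MII], [IIII], [MIIII], [IIIIII] and [MIIMII]. *)
Lemma ucycle_size_ge7 (c : seq T) : (2 < size c)%N ->
  ucycle (fun v w => I v w || M v w) c -> (6 < size c)%N.
Proof.
move=> c3 /andP[]; move: c3.
case: c => [|v1 [|v2 [|v3 [|v4 [|v5 [|v6 [|v7 c]]]]]]] // _ + hu.
- rewrite /= !andbT; distinctness hu; split_edges; exfalso; forbidden_pattern.
- rewrite /= !andbT; distinctness hu; split_edges; exfalso; forbidden_pattern.
- rewrite /= !andbT; distinctness hu; split_edges; exfalso; forbidden_pattern.
- rewrite /= !andbT; distinctness hu; split_edges; exfalso; forbidden_pattern.
Qed.

End GirthFromPatterns.

(** * Equalities certified by explicit linear combinations *)

Section LinearCombination.

Variable R : comPzRingType.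

(** Once the coefficient [c] is supplied, the second premise is an identity for [ring] or
    [field]. *)
Lemma eq_lincomb1 (a b x y c : R) : a = b -> x - y = c * (a - b) -> x = y.
Proof. by move=> -> /eqP; rewrite subrr mulr0 subr_eq0 => /eqP. Qed.

Lemma eq_lincomb2 (a b a' b' x y c c' : R) : a = b -> a' = b' ->
  x - y = c * (a - b) + c' * (a' - b') -> x = y.
Proof.
by move=> -> -> /eqP; rewrite !subrr !mulr0 addr0 subr_eq0 => /eqP.
Qed.

End LinearCombination.

Lemma cramer2 (K : fieldType) (a b c e x x' y y' : K) : a * e - b * c != 0 ->
  a * x + b * y = a * x' + b * y' -> c * x + e * y = c * x' + e * y' ->
  x = x' /\ y = y'.
Proof.
move=> det0 e1 e2.
by split; apply: (mulfI det0);
  [apply: (eq_lincomb2 (c := e) (c' := - b) e1 e2)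
  |apply: (eq_lincomb2 (c := - c) (c' := a) e1 e2)]; ring.
Qed.

(** * The symplectic quadrangle in coordinates *)

Section Geometry.

Variable F : finFieldType.

Local Notation dir := (option F).
Local Notation coords := (F * F)%type.
Local Notation point := (dir * coords)%type.
Local Notation line := ((F * F * F) + (dir * F))%type.

(* The symplectic space is x + y with y identified with the dual of x, and x, y
   both F^2. A remaining point is spanned by a vector (a, b) with a and b nonzero;
   it is encoded by the direction d of a in the projective line, a being
   normalized to (1, m) or (0, 1), and by the pair z with z.1 = a . b (see [dotE]).
   The point lies on a deleted line iff z.1 = 0.
   The line [inl (s, t, u)] consists of the vectors (a, S a) for the symmetric
   matrix S = [[s, t], [t, u]]; it meets x iff S is singular. The line
   [inr (d, c)] meets y: it contains the points of direction d with z.1 = c. *)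
Definition a1 (d : dir) : F := if d is Some _ then 1 else 0.
Definition a2 (d : dir) : F := if d is Some m then m else 1.
Definition b1 (d : dir) (z : coords) : F :=
  if d is Some m then z.1 - m * z.2 else - z.2.
Definition b2 (d : dir) (z : coords) : F := if d is Some m then z.2 else z.1.

Definition inc (p : point) (L : line) : bool :=
  match L with
  | inl (s, t, u) => (s * a1 p.1 + t * a2 p.1 == b1 p.1 p.2) &&
                     (t * a1 p.1 + u * a2 p.1 == b2 p.1 p.2)
  | inr (d, x) => (p.1 == d) && (p.2.1 == x)
  end.

Definition valid_point (p : point) : bool := p.2 != (0, 0).

(** The zero matrix is the line x itself; [inr (d, 0)] is the deleted line of direction d that meets
    both x and y. *)
Definition valid_line (L : line) : bool :=
  match L with inl stu => stu != (0, 0, 0) | inr (_, x) => x != 0 end.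

(** The symplectic form a . b' - a' . b vanishes on the spanning vectors: collinearity in the
    quadrangle. *)
Definition perp (p r : point) : Prop :=
  a1 p.1 * b1 r.1 r.2 + a2 p.1 * b2 r.1 r.2 =
  a1 r.1 * b1 p.1 p.2 + a2 r.1 * b2 p.1 p.2.

Lemma det_eq0 d e : a1 d * a2 e - a2 d * a1 e = 0 -> d = e.
Proof.
case: d e => [m|] [n|] //=; rewrite ?(mul0r, mul1r, mulr0, mulr1).
- by move/eqP; rewrite subr_eq0 => /eqP->.
- by move/eqP; rewrite subr0 oner_eq0.
- by move/eqP; rewrite sub0r oppr_eq0 oner_eq0.
Qed.

Lemma det_neq0 d e : d != e -> a1 d * a2 e - a2 d * a1 e != 0.
Proof. by apply: contra => /eqP /det_eq0 ->. Qed.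

Lemma dotE d z : a1 d * b1 d z + a2 d * b2 d z = z.1.
Proof. by case: d => [m|] /=; ring. Qed.

Lemma b_inj d z z' : b1 d z = b1 d z' -> b2 d z = b2 d z' -> z = z'.
Proof.
case: d z z' => [m|] [x y] [x' y'] /=; last by move/oppr_inj=> -> ->.
by move=> + e; rewrite e => /addIr ->.
Qed.

Lemma b_neq0 d z : z != (0, 0) -> b1 d z = 0 -> b2 d z = 0 -> False.
Proof.
move=> /eqP z0 e1 e2; apply: z0; apply: (b_inj (d := d)).
  by rewrite e1; case: d {e1 e2} => [m|] /=; ring.
by rewrite e2; case: d {e1 e2}.
Qed.

(* Applied to a pair of matched points: being perpendicular to both forces a point
   onto the deleted line that carries them. *)
Lemma same_dir (d : dir) (z z' : coords) (r : point) : z.1 = z'.1 -> z != z' ->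
  perp r (d, z) -> perp r (d, z') -> r.1 = d.
Proof.
case: z z' => [x y] [x' y'] /= <-; rewrite /perp /= => zz' e e'.
have yy' : y - y' != 0.
  by rewrite subr_eq0; apply: contra zz' => /eqP->.
apply: det_eq0; apply: (mulfI yy'); rewrite mulr0.
(* With d and [z.1] fixed, b varies only along (- a2, a1), the vector orthogonal to a. *)
have h1 : b1 d (x, y) - b1 d (x, y') = - a2 d * (y - y').
  by case: d {e e'} => [m|] /=; ring.
have h2 : b2 d (x, y) - b2 d (x, y') = a1 d * (y - y').
  by case: d {e e' h1} => [m|] /=; ring.
have e3 : a1 r.1 * (b1 d (x, y) - b1 d (x, y')) +
          a2 r.1 * (b2 d (x, y) - b2 d (x, y')) = 0.
  by apply: (eq_lincomb2 (c := 1) (c' := -1) e e'); ring.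
rewrite h1 h2 in e3.
by apply: (eq_lincomb1 (c := -1) e3); ring.
Qed.

Lemma perp_same_dir d z z' : perp (d, z) (d, z') -> z.1 = z'.1.
Proof. by rewrite /perp /= !dotE. Qed.

Lemma inc_perp p r L : inc p L -> inc r L -> perp p r.
Proof.
case: L => [[[s t] u]|[d x]] /=; rewrite /perp.
  by move=> /andP[/eqP<- /eqP<-] /andP[/eqP<- /eqP<-]; ring.
case: p r => [d1 z] [d2 z'] /= /andP[/eqP-> /eqP zx] /andP[/eqP-> /eqP zx'].
by rewrite !dotE zx zx'.
Qed.

Lemma inc_same_dir p r L : inc p L -> inc r L -> p.1 = r.1 -> p != r ->
  L = inr (p.1, p.2.1).
Proof.
case: p r L => [d z] [d' z'] [[[s t] u]|[e x]] /=.
  move=> /andP[/eqP h1 /eqP h2] /andP[/eqP h1' /eqP h2'] dd'; subst d'.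
  have -> : z = z' by apply: (b_inj (d := d)); rewrite -?h1 -?h1' -?h2 -?h2'.
  by rewrite eqxx.
by move=> /andP[/eqP-> /eqP->].
Qed.

(** Points of distinct directions have independent parts a, so the two values S a determine S row by
    row. Equal directions leave only a line [inr]. *)
Lemma inc_unique_line p r L N : p != r ->
  inc p L -> inc r L -> inc p N -> inc r N -> L = N.
Proof.
move=> pr pL rL pN rN; have [pr1|pr1] := eqVneq p.1 r.1.
  by rewrite (inc_same_dir pL rL pr1 pr) (inc_same_dir pN rN pr1 pr).
case: L pL rL => [[[s t] u]|[e x]] /=; last first.
  by move=> /andP[/eqP pe _] /andP[/eqP re _]; rewrite pe re eqxx in pr1.
case: N pN rN => [[[s' t'] u']|[e x]] /=; last first.
  by move=> /andP[/eqP pe _] /andP[/eqP re _]; rewrite pe re eqxx in pr1.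
move=> /andP[/eqP<- /eqP<-] /andP[/eqP<- /eqP<-].
move=> /andP[/eqP e1 /eqP e2] /andP[/eqP e1' /eqP e2'].
have [|||-> ->] := @cramer2 _ (a1 p.1) (a2 p.1) (a1 r.1) (a2 r.1) s s' t t'.
- exact: det_neq0.
- by apply: (eq_lincomb1 (c := 1) e1); ring.
- by apply: (eq_lincomb1 (c := 1) e1'); ring.
have [|||_ ->] // := @cramer2 _ (a1 p.1) (a2 p.1) (a1 r.1) (a2 r.1) t t' u u'.
- exact: det_neq0.
- by apply: (eq_lincomb1 (c := 1) e2); ring.
- by apply: (eq_lincomb1 (c := 1) e2'); ring.
Qed.

(** A line is a maximal totally isotropic subspace, so it equals its own orthogonal complement. *)
Lemma perp_inc p p' r L : p != p' -> inc p L -> inc p' L ->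
  perp r p -> perp r p' -> inc r L.
Proof.
move=> pp' pL p'L rp rp'; have [dd|dd] := eqVneq p.1 p'.1.
  rewrite (inc_same_dir pL p'L dd pp').
  have x_eq : p.2.1 = p'.2.1.
    case: p p' dd {pp' rp rp'} pL p'L => [d z] [d' z'] /= dd; subst d'.
    by move=> h h'; have := inc_perp h h'; apply: perp_same_dir.
  case: p p' r dd pp' x_eq rp rp' {pL p'L} => [d z] [d' z'] [e w] /= dd.
  subst d' => /eqP zz' x_eq rp rp'.
  have ed : e = d.
    by apply: (same_dir x_eq _ rp rp'); apply/eqP => zz; apply: zz'; rewrite zz.
  by rewrite ed in rp *; rewrite (perp_same_dir rp) !eqxx.
case: L pL p'L => [[[s t] u]|[e x]] /=; last first.
  by move=> /andP[/eqP pe _] /andP[/eqP re _]; rewrite pe re eqxx in dd.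
move=> /andP[/eqP e1 /eqP e2] /andP[/eqP e1' /eqP e2'].
move: rp rp'; rewrite /perp -e1 -e2 -e1' -e2' => rp rp'.
have [||| -> ->] := @cramer2 _ (a1 p.1) (a2 p.1) (a1 p'.1) (a2 p'.1)
  (s * a1 r.1 + t * a2 r.1) (b1 r.1 r.2) (t * a1 r.1 + u * a2 r.1) (b2 r.1 r.2).
- exact: det_neq0.
- by apply: (eq_lincomb1 (c := 1) rp); ring.
- by apply: (eq_lincomb1 (c := 1) rp'); ring.
by rewrite !eqxx.
Qed.

(** The corner [p3] is perpendicular to [p1] and [p2], hence lies on [L3]; then [L2] and [L3] share
    two points. *)
Lemma no_triangle p1 p2 p3 L1 L2 L3 : p1 != p2 -> p1 != p3 -> p2 != p3 ->
  inc p2 L1 -> inc p3 L1 -> inc p1 L2 -> inc p3 L2 -> inc p1 L3 -> inc p2 L3 ->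
  L2 = L3.
Proof.
move=> n12 n13 n23 h21 h31 h12 h32 h13 h23.
have h33 : inc p3 L3.
  apply: (perp_inc n12 h13 h23); first exact: inc_perp h32 h12.
  exact: inc_perp h31 h21.
exact: (inc_unique_line n13).
Qed.

(** * Lines with singular matrix *)

(* The lines that meet a deleted line in a deleted point. *)
Definition degenerate (L : line) : bool :=
  if L is inl (s, t, u) then s * u == t ^+ 2 else true.

(** Distinct points of one direction span [inr (d, c)] with c their first coordinate, and c = 0 is a
    deleted line. *)
Lemma isotropic_eq p r L : valid_line L -> p.2.1 = 0 -> p.1 = r.1 ->
  inc p L -> inc r L -> p = r.
Proof.
move=> vL p0 pr pL rL; apply/eqP; apply: contraTT vL => npr.
by rewrite (inc_same_dir pL rL pr npr) /= p0 eqxx.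
Qed.

(** If det S = 0 and b = S a, then b1^2 = s (a . b) and b2^2 = u (a . b), so a . b = 0 would force b
    = 0. Hence a matched line carries no matched point. *)
Lemma degenerate_anisotropic p L : degenerate L -> valid_line L ->
  valid_point p -> inc p L -> p.2.1 != 0.
Proof.
case: p L => [d z] [[[s t] u]|[e x]] /=; last by move=> _ x0 _ /andP[_ /eqP->].
move=> /eqP su _ vp /andP[/eqP e1 /eqP e2]; apply: contraL vp => /eqP z0.
apply/negP => /(@b_neq0 d); apply.
  apply/eqP; rewrite -sqrf_eq0; apply/eqP.
  apply: (@eq_lincomb2 _ z.1 0 (s * u) (t ^+ 2) _ _ s (- a2 d ^+ 2)) => //.
  by rewrite -(dotE d z) -e1 -e2; ring.
apply/eqP; rewrite -sqrf_eq0; apply/eqP.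
apply: (@eq_lincomb2 _ z.1 0 (s * u) (t ^+ 2) _ _ u (- a1 d ^+ 2)) => //.
by rewrite -(dotE d z) -e1 -e2; ring.
Qed.

(** In matrix form (a . b) S = b b^T, as S has rank at most one. A point with a . b nonzero thus
    determines S. *)
Lemma degenerate_coords s t u d z : degenerate (inl (s, t, u)) ->
  inc (d, z) (inl (s, t, u)) ->
  [/\ z.1 * s = b1 d z ^+ 2, z.1 * t = b1 d z * b2 d z & z.1 * u = b2 d z ^+ 2].
Proof.
move=> /eqP su /= /andP[/eqP e1 /eqP e2]; rewrite -(dotE d z) -e1 -e2; split.
- by apply: (eq_lincomb1 (c := a2 d ^+ 2) su); ring.
- by apply: (eq_lincomb1 (c := - (a1 d * a2 d)) su); ring.
- by apply: (eq_lincomb1 (c := a1 d ^+ 2) su); ring.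
Qed.

Lemma degenerate_inj p T T' : degenerate (inl T) -> degenerate (inl T') ->
  p.2.1 != 0 -> inc p (inl T) -> inc p (inl T') -> T = T'.
Proof.
case: p T T' => [d z] [[s t] u] [[s' t'] u'] dT dT' z0 pT pT'.
have [es et eu] := degenerate_coords dT pT.
have [es' et' eu'] := degenerate_coords dT' pT'.
by congr (_, _, _); apply: (mulfI z0); rewrite ?es ?et ?eu.
Qed.

(** * The matchings and the patterns they avoid *)

Section Matching.

Variable nu : F -> F.

Hypothesis two_neq0 : 2%:R != 0 :> F.
Hypothesis nu0 : nu 0 = 0.
Hypothesis nuK : involutive nu.
Hypothesis nu_neq : forall x : F, x != 0 -> nu x != x.
Hypothesis nu_neq_opp : forall x : F, x != 0 -> nu x != - x.
Hypothesis nu_opp_nu : forall x : F, x != 0 -> nu (- nu x) != - x.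

Definition mate_point (p r : point) : bool :=
  [&& p.1 == r.1, p.2.1 == 0, r.2.1 == 0 & r.2.2 == nu p.2.2].

(** The nonzero singular matrices with a given kernel are the nonzero multiples of one of them, and
    their lines share a deleted point of x; the lines [inr (d, _)] share a deleted point of y. *)
Definition mate_line (L N : line) : bool :=
  match L, N with
  | inl (s, t, u), inl T => (s * u == t ^+ 2) && (T == (- s, - t, - u))
  | inr (d, x), inr (e, y) => (d == e) && (y == nu x)
  | _, _ => false
  end.

Lemma mate_point_sym : symmetric mate_point.
Proof.
suff imp p r : mate_point p r -> mate_point r p.
  by move=> p r; apply/idP/idP; apply: imp.
by move=> /and4P[/eqP h1 h2 h3 /eqP h4]; rewrite /mate_point h1 h2 h3 h4 nuK !eqxx.
Qed.

Lemma mate_line_sym : symmetric mate_line.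
Proof.
suff imp L N : mate_line L N -> mate_line N L.
  by move=> L N; apply/idP/idP; apply: imp.
case: L N => [[[s t] u]|[d x]] [[[s' t'] u']|[e y]] //=.
  by move=> /andP[su /eqP[-> -> ->]]; rewrite mulrNN sqrrN su !opprK eqxx.
by move=> /andP[/eqP-> /eqP->]; rewrite nuK !eqxx.
Qed.

Lemma mate_point_functional p r r' : mate_point p r -> mate_point p r' -> r = r'.
Proof.
case: p r r' => [d [x y]] [d1 [x1 y1]] [d2 [x2 y2]]; rewrite /mate_point /=.
by move=> /and4P[/eqP<- _ /eqP-> /eqP->] /and4P[/eqP<- _ /eqP-> /eqP->].
Qed.

Lemma mate_line_functional L N N' : mate_line L N -> mate_line L N' -> N = N'.
Proof.
case: L N N' => [[[s t] u]|[d x]] [T|[d1 x1]] [T'|[d2 x2]] //=.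
  by move=> /andP[_ /eqP->] /andP[_ /eqP->].
by move=> /andP[/eqP<- /eqP->] /andP[/eqP<- /eqP->].
Qed.

Lemma isotropic_y_neq0 (p : point) : valid_point p -> p.2.1 = 0 -> p.2.2 != 0.
Proof.
by case: p => [d [x y]] /= + x0; rewrite /valid_point /= x0; apply: contra => /eqP->.
Qed.

Lemma mate_point_irrefl p : valid_point p -> ~~ mate_point p p.
Proof.
move=> vp; apply/negP => /and4P[_ /eqP p0 _ /eqP e].
by move: (nu_neq (isotropic_y_neq0 vp p0)); rewrite -e eqxx.
Qed.

Lemma opp_neq (x : F) : x != 0 -> - x != x.
Proof.
by move=> x0; rewrite eq_sym -addr_eq0 -mulr2n -mulr_natr mulf_neq0.
Qed.

Lemma mate_line_irrefl L : valid_line L -> ~~ mate_line L L.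
Proof.
case: L => [[[s t] u]|[d x]] /=; last first.
  by move=> x0; rewrite eqxx eq_sym nu_neq.
apply: contra => /andP[_ /eqP[es et eu]].
suff neg0 (x : F) : x = - x -> x = 0 by rewrite (neg0 s es) (neg0 t et) (neg0 u eu).
by move=> xN; apply/eqP; apply/negPn/negP => /opp_neq; rewrite -xN eqxx.
Qed.

Lemma mate_line_degenerate L N : mate_line L N -> degenerate L.
Proof. by case: L N => [[[s t] u]|[d x]] [T|[e y]] //= /andP[]. Qed.

(** A point perpendicular to both mates has their direction by [same_dir]; [isotropic_eq] then
    identifies it with each of them. *)
Lemma mate_point_path4 p p' r L L' : valid_line L -> valid_line L' ->
  valid_point p -> mate_point p p' ->
  inc p L -> inc r L -> inc p' L' -> inc r L' -> False.
Proof.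
move=> vL vL' vp pp' pL rL p'L' rL'.
have npp' : p != p'.
  by apply/eqP => e; move: pp'; rewrite -e; apply/negP/mate_point_irrefl.
case/and4P: (pp') => /eqP dd /eqP p0 /eqP p'0 _.
have rd : r.1 = p.1.
  have := inc_perp rL pL; have := inc_perp rL' p'L'.
  case: p p' dd npp' p0 p'0 {vp pp' pL p'L'} => [d z] [d' z'] /= <-.
  move=> /eqP npp' z0 z'0 rp' rp; apply: (same_dir _ _ rp rp').
    by rewrite z0 z'0.
  by apply/eqP => zz'; apply: npp'; rewrite zz'.
have pr := isotropic_eq vL p0 (esym rd) pL rL.
have p'r : p' = r by apply: (isotropic_eq vL' p'0) => //; rewrite -dd rd.
by rewrite pr p'r eqxx in npp'.
Qed.

(** For the matrices S and - S, perpendicularity reads 2 (a' . S a) = 0. For lines [inr] it would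
    make the first coordinates x and nu x equal. *)
Lemma mate_line_not_perp L L' p p' : valid_line L -> valid_line L' ->
  valid_point p -> valid_point p' -> mate_line L L' ->
  inc p L -> inc p' L' -> perp p p' -> False.
Proof.
move=> vL vL' vp vp' LL' pL p'L'.
have dL := mate_line_degenerate LL'.
have dL' : degenerate L' by apply: (@mate_line_degenerate _ L); rewrite mate_line_sym.
have x0 := degenerate_anisotropic dL vL vp pL.
have x'0 := degenerate_anisotropic dL' vL' vp' p'L'.
case: p p' L L' vL {vL' vp vp' dL dL'} LL' pL p'L' x0 x'0
  => [d z] [d' z'] [[[s t] u]|[e x]] [[[s' t'] u']|[e' x']] //=.
  move=> _ /andP[/eqP su /eqP[-> -> ->]].
  move=> /andP[/eqP e1 /eqP e2] /andP[/eqP e1' /eqP e2'].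
  move=> x0 x'0; have := mulf_neq0 x0 x'0.
  rewrite /perp /= -(dotE d z) -(dotE d' z') -e1 -e2 -e1' -e2' => xx' h.
  set X := a1 d' * (s * a1 d + t * a2 d) + a2 d' * (t * a1 d + u * a2 d).
  have X0 : X = 0.
    apply: (mulfI two_neq0); apply: (eq_lincomb1 (c := -1) h).
    by rewrite /X; ring.
  move/negP: xx'; apply; apply/eqP.
  (* The identity is (a . S a)(a' . S a') = (a' . S a)^2 + det S det(a, a')^2, whose right side is
     now 0. *)
  apply: (eq_lincomb2 (c := - (a1 d * a2 d' - a2 d * a1 d') ^+ 2) (c' := - X) su X0).
  by rewrite /X; ring.
move=> x0 /andP[/eqP<- /eqP->] /andP[/eqP-> /eqP zx] /andP[/eqP-> /eqP z'x].
move=> _ _ /perp_same_dir; rewrite zx z'x => /esym/eqP.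
by apply/negP/nu_neq.
Qed.

(** Collinear points with first coordinate 0 and distinct directions have opposite second
    coordinates. Going round the hexagon gives nu (- nu y) = - y. *)
Lemma mate_point_square p p' r r' L L' : valid_line L -> valid_line L' ->
  valid_point p -> mate_point p p' -> mate_point r r' -> p' != r ->
  inc p' L -> inc r L -> inc r' L' -> inc p L' -> False.
Proof.
move=> vL vL' vp pp' rr' np'r p'L rL r'L' pL'.
have p'r := inc_perp p'L rL; have r'p := inc_perp r'L' pL'.
case/and4P: pp' rr' => /eqP dp /eqP p0 /eqP p'0 /eqP yp.
case/and4P=> /eqP dr /eqP r0 /eqP r'0 /eqP yr.
have [pr|pr] := eqVneq p'.1 r.1.
  by rewrite (isotropic_eq vL p'0 pr p'L rL) eqxx in np'r.
have y0 := isotropic_y_neq0 vp p0.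
(* When a . b = 0, b is the multiple [z.2] of (- a2, a1), so the form becomes a multiple of the
   determinant of the directions. *)
have b1E (q : point) : q.2.1 = 0 -> b1 q.1 q.2 = - (q.2.2 * a2 q.1).
  by case: q => [[m|] [x y]] /= e; rewrite ?e; ring.
have b2E (q : point) : q.2.1 = 0 -> b2 q.1 q.2 = q.2.2 * a1 q.1.
  by case: q => [[m|] [x y]] /= e; rewrite ?e; ring.
rewrite /perp !b1E // !b2E // -?dp -?dr yp ?yr in p'r r'p pr *.
have det0 := det_neq0 pr.
have e1 : r.2.2 = - nu p.2.2.
  by apply: (mulfI det0); apply: (eq_lincomb1 (c := -1) p'r); ring.
have e2 : nu r.2.2 = - p.2.2.
  by apply: (mulfI det0); apply: (eq_lincomb1 (c := 1) r'p); ring.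
by move: (nu_opp_nu y0); rewrite -e1 e2 eqxx.
Qed.

(** Matched lines of the same kind through p coincide. For different kinds, p and p' have the same
    direction: the graphs of S and - S give opposite values of a . b, while the [inr] mates give
    values related by nu. *)
Lemma mate_line_square L L' N N' p p' : valid_line L' -> valid_line N ->
  valid_point p -> mate_line L L' -> mate_line N N' -> L' != N ->
  inc p L' -> inc p N -> inc p' N' -> inc p' L -> False.
Proof.
move=> vL' vN vp LL' NN' nL'N pL' pN p'N' p'L.
have dL' : degenerate L' by apply: (@mate_line_degenerate _ L); rewrite mate_line_sym.
have dN := mate_line_degenerate NN'.
have x0 := degenerate_anisotropic dL' vL' vp pL'.
case: L L' vL' LL' nL'N pL' p'L dL' => [[[s t] u]|[d x]] [[[s' t'] u']|[d' x']] //.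
  move=> _ /= /andP[_ /eqP[-> -> ->]] nL'N pL' p'L dL'.
  case: N N' vN NN' nL'N pN p'N' dN => [[[s1 t1] u1]|[e y]] [T'|[e' y']] // vN NN' nL'N pN p'N' dN.
    by move/eqP: nL'N; apply; congr inl; exact: (@degenerate_inj p (- s, - t, - u) (s1, t1, u1)).
  move: NN' pN p'N' pL' p'L => /= /andP[/eqP<- /eqP->].
  case: p p' vp x0 => [d z] [d' z'] /= vp x0 /andP[/eqP-> /eqP zx] /andP[/eqP-> /eqP zx'].
  move=> /andP[/eqP e1 /eqP e2] /andP[/eqP e1' /eqP e2'].
  move: (nu_neq_opp vN); rewrite -zx' -zx -(dotE e z) -(dotE e z') -e1 -e2 -e1' -e2'.
  by move/eqP; apply; ring.
move=> vL' /= /andP[/eqP<- /eqP xx'] nL'N pL' p'L dL'.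
case: N N' vN NN' nL'N pN p'N' dN => [[[s t] u]|[e y]] [T'|[e' y']] // vN NN' nL'N pN p'N' dN; last first.
  move: pL' pN nL'N => /= /andP[/eqP-> /eqP->] /andP[/eqP-> /eqP->].
  by rewrite eqxx.
move: NN' pN p'N' pL' p'L => /= /andP[_ /eqP->].
case: p p' vp x0 => [e z] [e' z'] /= vp x0 pN p'N' /andP[/eqP ed /eqP zx'] /andP[/eqP e'd /eqP zx].
move: pN p'N'; rewrite ed e'd => /andP[/eqP e1 /eqP e2] /andP[/eqP e1' /eqP e2'].
move: vL' xx' zx' => /= vL' xx' zx'; move: (nu_neq_opp vL').
rewrite {1}xx' nuK -zx -zx' -(dotE d z) -(dotE d z') -e1 -e2 -e1' -e2'.
by move/eqP; apply; ring.
Qed.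

(** * The graph and its lack of cycles shorter than 7 *)

Local Notation raw_vertex := (point + line)%type.

Definition valid_vertex (r : raw_vertex) : bool :=
  match r with inl p => valid_point p | inr L => valid_line L end.

Definition vertex_inc (v w : raw_vertex) : bool :=
  match v, w with
  | inl p, inr L | inr L, inl p => inc p L
  | _, _ => false
  end.

Definition vertex_mate (v w : raw_vertex) : bool :=
  match v, w with
  | inl p, inl r => mate_point p r
  | inr L, inr N => mate_line L N
  | _, _ => false
  end.

Definition vertex_adj : rel raw_vertex :=
  fun v w => vertex_inc v w || vertex_mate v w.

Definition is_point (v : raw_vertex) : bool := if v is inl _ then true else false.

Lemma vertex_inc_sym : symmetric vertex_inc.
Proof. by move=> [p|L] [r|N]. Qed.

Lemma vertex_mate_sym : symmetric vertex_mate.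
Proof. by move=> [p|L] [r|N] //=; rewrite (mate_point_sym, mate_line_sym). Qed.

Lemma vertex_adj_sym : symmetric vertex_adj.
Proof. by move=> v w; rewrite /vertex_adj vertex_inc_sym vertex_mate_sym. Qed.

Lemma vertex_adj_irrefl v : valid_vertex v -> vertex_adj v v = false.
Proof.
case: v => [p|L] /= h; apply/negbTE; first exact: mate_point_irrefl.
exact: mate_line_irrefl.
Qed.

Definition gvertex := {v : raw_vertex | valid_vertex v}.

Lemma gvertex_ucycle_ge7 (c : seq gvertex) : (2 < size c)%N ->
  ucycle (relpre val vertex_adj) c -> (6 < size c)%N.
Proof.
pose I : rel gvertex := relpre val vertex_inc.
pose M : rel gvertex := relpre val vertex_mate.
apply: (@ucycle_size_ge7 _ (is_point \o val) I M).
- by move=> v w; rewrite /M /= vertex_mate_sym.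
- by move=> [[p|L] ?] [[r|N] ?].
- by move=> [[p|L] ?] [[r|N] ?].
- move=> u v w uv uw; apply: val_inj; move: u v w uv uw.
  move=> [[p|L] ?] [[r|N] ?] [[r'|N'] ?] //; rewrite /M /= => h h'.
    by rewrite (mate_point_functional h h').
  by rewrite (mate_line_functional h h').
- move=> v1 v2 v3 v4; rewrite /= !inE !negb_or -!andbA -!(inj_eq val_inj).
  have core (p p' : point) (L L' : line) :
      inl p != inl p' :> raw_vertex -> inr L != inr L' :> raw_vertex ->
      inc p L -> inc p' L -> inc p L' -> inc p' L' -> False.
    move=> /eqP pp' /eqP LL' pL p'L pL' p'L'; apply: LL'; congr inr.
    apply: inc_unique_line pL p'L pL' p'L'.
    by apply/eqP => e; apply: pp'; rewrite e.
  move=> /and5P[_ n13 _ _ /andP[n24 _]].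
  case: v1 v2 v3 v4 n13 n24 => [[p1|L1] ?] [[p2|L2] ?] [[p3|L3] ?] [[p4|L4] ?] //.
    move=> n13 n24 h12 h23 h34 h41; exact: (core _ _ _ _ n13 n24).
  move=> n13 n24 h12 h23 h34 h41; exact: (core _ _ _ _ n24 n13).
- move=> v1 v2 v3 v4 v5 v6; rewrite /= !inE !negb_or -!andbA -!(inj_eq val_inj).
  have core (p1 p2 p3 : point) (L1 L2 L3 : line) :
      inl p1 != inl p2 :> raw_vertex -> inl p1 != inl p3 :> raw_vertex ->
      inl p2 != inl p3 :> raw_vertex -> inr L2 != inr L3 :> raw_vertex ->
      inc p2 L1 -> inc p3 L1 -> inc p1 L2 -> inc p3 L2 -> inc p1 L3 ->
      inc p2 L3 -> False.
    move=> n12 n13 n23 nL h1 h2 h3 h4 h5 h6; move/eqP: nL; apply; congr inr.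
    have inlN (p r : point) : inl p != inl r :> raw_vertex -> p != r.
      by apply: contra => /eqP->.
    by apply: (@no_triangle p1 p2 p3 L1 L2 L3) => //; apply: inlN.
  case/and5P=> _ n13 _ n15 /and5P[_ _ n24 _ /and5P[n26 _ n35 _ /and3P[_ n46 _]]].
  case: v1 v2 v3 v4 v5 v6 n13 n15 n24 n26 n35 n46 =>
    [[p1|L1] ?] [[p2|L2] ?] [[p3|L3] ?] [[p4|L4] ?] [[p5|L5] ?] [[p6|L6] ?] //.
    move=> n13 n15 n24 n26 n35 n46 h12 h23 h34 h45 h56 h61.
    by apply: (@core p1 p3 p5 L4 L6 L2); rewrite // eq_sym.
  move=> n13 n15 n24 n26 n35 n46 h12 h23 h34 h45 h56 h61.
  by apply: (@core p2 p4 p6 L5 L1 L3).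
(* Triangles are collapsed instances of the pentagon lemmas: r = p for points, and p' = p,
   perpendicular to itself, for lines. *)
- move=> [[p1|L1] q1] [[p2|L2] q2] [[p3|L3] q3] //; rewrite /I /M /= => h12 h23 h31.
    exact: (mate_point_path4 q3 q3 q1 h12 h31 h31 h23 h31).
  exact: (mate_line_not_perp q1 q2 q3 q3 h12 h31 h23).
- have core (p p' : point) (L L' : line) : valid_vertex (inl p') ->
    valid_vertex (inr L) -> mate_point p p' -> inc p' L -> mate_line L L' -> False.
    move=> vp vL /and4P[_ _ p'0 _] p'L /mate_line_degenerate dL.
    by move: (degenerate_anisotropic dL vL vp p'L); rewrite p'0.
  move=> [[p1|L1] q1] [[p2|L2] q2] [[p3|L3] q3] [[p4|L4] q4] //;
    rewrite /I /M /= => h12 h23 h34.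
    exact: (core p1 p2 L3 L4).
  by apply: (core p4 p3 L2 L1) => //; rewrite (mate_point_sym, mate_line_sym).
- move=> [[p1|L1] q1] [[p2|L2] q2] [[p3|L3] q3] [[p4|L4] q4] [[p5|L5] q5] //;
    rewrite /I /M /= => h12 h23 h34 h45 h51.
    exact: (mate_point_path4 q5 q3 q1 h12 h51 h45 h23 h34).
  exact: (mate_line_not_perp q1 q2 q5 q3 h12 h51 h23 (inc_perp h45 h34)).
- move=> v1 v2 v3 v4 v5 v6; rewrite -(inj_eq val_inj).
  case: v1 v2 v3 v4 v5 v6 =>
    [[p1|L1] q1] [[p2|L2] q2] [[p3|L3] q3] [[p4|L4] q4] [[p5|L5] q5] [[p6|L6] q6] //;
    rewrite /I /M /= => n24 h12 h23 h34 h45 h56 h61.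
    apply: (mate_point_square q3 q6 q1 h12 h45 _ h23 h34 h56 h61).
    by apply: contra n24 => /eqP->.
  apply: (mate_line_square q2 q4 q3 h12 h45 _ h23 h34 h56 h61).
  by apply: contra n24 => /eqP->.
Qed.

(** * Neighbourhoods, regularity, order and a 7-cycle *)

(* With f(m) = s + 2 t m + u m^2, the point of direction m on [inl (s, t, u)] has
   coordinates (f(m), f'(m) / 2). *)
Definition tangent (T : F * F * F) (d : dir) : coords :=
  let: (s, t, u) := T in
  if d is Some m then (s + 2%:R * t * m + u * m ^+ 2, t + u * m) else (u, - t).

(** The symmetric S with S a = b form an affine line; the parameter is the entry u if a = (1, m) and
    s if a = (0, 1). *)
Definition pencil (d : dir) (z : coords) (c : F) : F * F * F :=
  if d is Some m then
    let t := z.2 - c * m in (z.1 - m * z.2 - t * m, t, c)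
  else (c, - z.2, z.1).

Definition pencil_index (d : dir) (T : F * F * F) : F :=
  let: (s, t, u) := T in if d is Some _ then u else s.

Lemma inc_tangent d z T : inc (d, z) (inl T) = (z == tangent T d).
Proof.
case: T z d => [[s t] u] [x y] [m|] /=; rewrite xpair_eqE.
  apply/andP/andP => -[/eqP e1 /eqP e2]; split; apply/eqP.
  - by apply: (eq_lincomb2 (c := - 1) (c' := - m) e1 e2); ring.
  - by apply: (eq_lincomb1 (c := - 1) e2); ring.
  - by apply: (eq_lincomb2 (c := - 1) (c' := m) e1 e2); ring.
  - by apply: (eq_lincomb1 (c := - 1) e2); ring.
rewrite !mulr0 !mulr1 !add0r andbC [in RHS]eq_sym; congr andb.
by rewrite [y == _]eq_sym eqr_oppLR.
Qed.

Lemma inc_pencil d z T : inc (d, z) (inl T) = (T == pencil d z (pencil_index d T)).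
Proof.
case: T z d => [[s t] u] [x y] [m|] /=; rewrite !xpair_eqE ?(mulr0, mulr1, add0r) eqxx ?andbT.
  apply/andP/andP => -[/eqP e1 /eqP e2]; split; apply/eqP.
  - by apply: (eq_lincomb2 (c := 1) (c' := - m) e1 e2); ring.
  - by apply: (eq_lincomb1 (c := 1) e2); ring.
  - by apply: (eq_lincomb2 (c := 1) (c' := m) e1 e2); ring.
  - by apply: (eq_lincomb1 (c := 1) e2); ring.
by [].
Qed.

Lemma pencilK d z : cancel (pencil d z) (pencil_index d).
Proof. by case: d => [m|] c. Qed.

Lemma inc_in_pencil d z c : inc (d, z) (inl (pencil d z c)).
Proof. by rewrite inc_pencil pencilK. Qed.

Lemma tangent0 d : tangent (0, 0, 0) d = (0, 0).
Proof. by case: d => [m|] /=; congr (_, _); ring. Qed.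

Lemma valid_pencil d z c : z != (0, 0) -> valid_line (inl (pencil d z c)).
Proof.
apply: contra => /eqP p0; have := inc_in_pencil d z c.
by rewrite p0 inc_tangent tangent0.
Qed.

Lemma tangent_eq0_degenerate T d : tangent T d = (0, 0) -> degenerate (inl T).
Proof.
case: T d => [[s t] u] [m|] /= [].
  by move=> e1 e2; apply/eqP; apply: (eq_lincomb2 (c := u) (c' := - (t + u * m)) e1 e2); ring.
by move=> -> /eqP; rewrite oppr_eq0 => /eqP->; rewrite mulr0 expr0n.
Qed.

(** The direction is the kernel of S: (0, 1) if u = 0, and (1, - t / u) otherwise. *)
Lemma degenerate_tangent_eq0 T : degenerate (inl T) -> exists d, tangent T d = (0, 0).
Proof.
case: T => [[s t] u] /= /eqP su; have [u0|u0] := eqVneq u 0.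
  exists None; congr (_, _) => //; move/esym/eqP: su.
  by rewrite u0 mulr0 sqrf_eq0 => /eqP->; rewrite oppr0.
exists (Some (- t / u)); congr (_, _); last by field.
by apply: (mulfI u0); apply: (eq_lincomb1 (c := 1) su); field.
Qed.

Lemma tangent_eq0_unique T d e : T != (0, 0, 0) -> tangent T d = (0, 0) ->
  tangent T e = (0, 0) -> d = e.
Proof.
move=> T0 td te; apply/eqP; apply: contraNT T0 => de; apply/eqP.
(* Two kernel directions are two points of x on the line of T, which is therefore x, the zero
   matrix. *)
have pN : (d, (0, 0)) != (e, (0, 0)) :> point by rewrite xpair_eqE (negbTE de).
have -> // : T = (0, 0, 0).
apply: (@inl_inj _ (dir * F)%type).
by apply: (inc_unique_line pN); rewrite inc_tangent ?td ?te ?tangent0.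
Qed.

(** The indices are the q + 1 neighbours in the quadrangle; where that neighbour is deleted, its
    place is taken by the mate. *)
Definition neighbour (v : raw_vertex) (o : option F) : raw_vertex :=
  match v with
  | inl (d, z) =>
      if o is Some c then inr (inl (pencil d z c))
      else if z.1 == 0 then inl (d, (0, nu z.2)) else inr (inr (d, z.1))
  | inr (inl T) =>
      if tangent T o == (0, 0) then let: (s, t, u) := T in inr (inl (- s, - t, - u))
      else inl (o, tangent T o)
  | inr (inr (d, x)) => if o is Some y then inl (d, (x, y)) else inr (inr (d, nu x))
  end.

Lemma neighbour_inj v : valid_vertex v -> injective (neighbour v).
Proof.
case: v => [[d z]|[[[s t] u]|[d x]]] v0 a b.
- case: a b => [a|] [b|] //=; [move=> e|by case: eqP|by case: eqP].
  by congr Some; apply: (can_inj (@pencilK d z)); apply: inl_inj (inr_inj e).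
- rewrite /neighbour; case: eqP => [ta|_]; case: eqP => [tb|_] //.
    by move=> _; apply: (tangent_eq0_unique v0).
  by move=> [->].
- by case: a b => [a|] [b|] //= [->].
Qed.

Lemma neighbourP v r : valid_vertex v ->
  reflect (exists o, r = neighbour v o) (valid_vertex r && vertex_adj v r).
Proof.
case: v => [[d z]|[[[s t] u]|[d x]]] v0.
- apply: (iffP andP) => [|[[c|] ->]].
  + case: r => [[e w]|[T|[e y]]] [vr]; rewrite /vertex_adj /= ?orbF.
    * case/and4P => /= /eqP<- z0 /eqP w0 /eqP w2; exists None; rewrite /= z0.
      by case: w w0 w2 {vr} => w1 w2 /= -> ->.
    * by rewrite -/(inc (d, z) (inl T)) inc_pencil => /eqP->; exists (Some (pencil_index d T)).
    * by move=> /andP[/eqP<- /eqP zy]; exists None; rewrite /= zy (negbTE vr).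
  + by split; [apply: valid_pencil|apply/orP; left; apply: inc_in_pencil].
  + rewrite /neighbour; case: eqP => [z0|/eqP z0]; last by rewrite /vertex_adj /= !eqxx.
    rewrite /vertex_adj /= /mate_point /= z0 !eqxx; split=> //.
    have y0 := @isotropic_y_neq0 (d, z) v0 z0.
    (* The involution fixes 0, so the mate of a nonzero scalar is nonzero. *)
    rewrite /valid_point xpair_eqE eqxx /=; apply: contra y0 => /eqP /(congr1 nu).
    by rewrite nuK nu0 => /= ->.
- apply: (iffP andP) => [|[o ->]].
  + case: r => [[e w]|[T|[e y]]] [vr] //; rewrite /vertex_adj.
      rewrite /vertex_inc /vertex_mate orbF inc_tangent => /eqP tE; exists e.
      rewrite /neighbour -tE ifN //.
    move=> /andP[su /eqP->].
    have [o to] := @degenerate_tangent_eq0 (s, t, u) su.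
    by exists o; rewrite /neighbour to eqxx.
  + rewrite /neighbour; case: eqP => [to|/eqP to].
      have dT := tangent_eq0_degenerate to.
      split; last by rewrite /vertex_adj /=; apply/andP; split.
      by apply: contra v0 => /eqP[/eqP + /eqP + /eqP]; rewrite !oppr_eq0 => /eqP-> /eqP-> /eqP->.
    by split=> //; rewrite /vertex_adj /vertex_inc inc_tangent eqxx.
- apply: (iffP andP) => [|[[y|] ->]].
  + case: r => [[e w]|[T|[e y]]] [vr] //; rewrite /vertex_adj /= ?orbF.
      by move=> /andP[/eqP<- /eqP<-]; exists (Some w.2); case: w {vr}.
    by move=> /andP[/eqP<- /eqP->]; exists None.
  + by rewrite /vertex_adj /= !eqxx; split=> //; apply: contra v0 => /eqP[->].
  + rewrite /vertex_adj /= !eqxx; split=> //; apply: contra v0 => /eqP /(congr1 nu).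
    by rewrite nuK nu0 => ->.
Qed.

Lemma card_neighbours (v : gvertex) :
  #|[set w : gvertex | relpre val vertex_adj v w]| = #|F|.+1.
Proof.
rewrite -(card_imset _ val_inj) -card_option -cardsT.
rewrite -(card_imset _ (neighbour_inj (valP v))); congr #|pred_of_set _|.
apply/setP => r; apply/imsetP/imsetP => [[w] | [o _ ->]].
  rewrite inE => vw ->; have /(neighbourP _ (valP v))[o ->] : valid_vertex (val w) &&
    vertex_adj (val v) (val w) by rewrite (valP w).
  by exists o.
have /andP[vr vo] : valid_vertex (neighbour (val v) o) &&
  vertex_adj (val v) (neighbour (val v) o) by apply/(neighbourP _ (valP v)); exists o.
by exists (Sub (neighbour (val v) o) vr); rewrite ?inE SubK.
Qed.

(** For q = 11 the bound is 1440 points and 1330 + 120 lines, 2890 in all. *)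
Lemma card_gvertex : (#|{: gvertex}| <=
  #|F|.+1 * (#|F| * #|F|).-1 +
    ((#|F| * #|F| * #|F|).-1 + #|F|.+1 * #|F|.-1))%N.
Proof.
pose P : {set point} := setX setT [set~ (0, 0)].
pose A : {set F * F * F} := [set~ (0, 0, 0)].
pose B : {set dir * F} := setX setT [set~ 0].
have sub : [set r : raw_vertex | valid_vertex r] \subset
    (inl @: P) :|: (inr @: ((inl @: A) :|: (inr @: B))).
  apply/subsetP => -[[d z]|[T|[d x]]]; rewrite !inE /= => v0; apply/orP.
  - by left; apply: imset_f; rewrite !inE.
  - by right; apply: imset_f; rewrite inE imset_f // !inE.
  - by right; apply: imset_f; rewrite inE orbC imset_f // !inE.
rewrite card_sig -cardsE; apply: leq_trans (subset_leq_card sub) _.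
apply: leq_trans (leq_card_setU _ _) (leq_add _ _).
  by rewrite card_imset; [rewrite cardsX cardsT cardsC1 card_option card_prod|exact: inl_inj].
rewrite card_imset; last exact: inr_inj.
apply: leq_trans (leq_card_setU _ _) (leq_add _ _).
  by rewrite card_imset; [rewrite cardsC1 !card_prod|exact: inl_inj].
by rewrite card_imset; [rewrite cardsX cardsT cardsC1 card_option|exact: inr_inj].
Qed.

Lemma gvertex_7cycle : exists c : seq gvertex,
  size c = 7 /\ ucycle (relpre val vertex_adj) c.
Proof.
have one0 : 1 != 0 :> F by exact: oner_neq0.
have n1 : nu 1 != 0 by apply: contra one0 => /eqP /(congr1 nu); rewrite nuK nu0 => ->.
have n11 : nu 1 != 1 by exact: nu_neq.
(* The mates [p 1] and [p (nu 1)] are joined by six incidence edges through the line [g]; one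
   matching edge closes the cycle. *)
pose p y : raw_vertex := inl (None, (0, y)).
pose f y : raw_vertex := inr (inl (1, - y, 0)).
pose r y : raw_vertex := inl (Some 0, (1, - y)).
pose g : raw_vertex := inr (inr (Some 0, 1)).
pose raws : seq raw_vertex := [:: p 1; f 1; r 1; g; r (nu 1); f (nu 1); p (nu 1)].
have valid_raws : all valid_vertex raws.
  by rewrite /= /valid_point /= !xpair_eqE !(negbTE one0) (negbTE n1) !andbF.
have map_insub s : all valid_vertex s ->
    map val (pmap (insub : _ -> option gvertex) s) = s.
  by elim: s => //= v s IHs /andP[vr vs]; rewrite insubT /= IHs.
have map_raws := map_insub raws valid_raws.
exists (pmap insub raws); split; first by rewrite -(size_map val) map_raws.
rewrite /ucycle -(map_inj_uniq val_inj) -cycle_map map_raws.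
have pf y : vertex_adj (p y) (f y).
  apply/orP; left; rewrite -[vertex_inc _ _]/(inc (None, (0, y)) (inl (1, - y, 0))).
  by rewrite inc_tangent /= opprK.
have rf y : vertex_adj (r y) (f y).
  apply/orP; left; rewrite -[vertex_inc _ _]/(inc (Some 0, (1, - y)) (inl (1, - y, 0))).
  by rewrite inc_tangent; apply/eqP; congr (_, _); ring.
have rg y : vertex_adj (r y) g by rewrite /vertex_adj /= !eqxx.
have pp : vertex_adj (p (nu 1)) (p 1).
  by rewrite /vertex_adj /= /mate_point /= nuK !eqxx.
apply/andP; split.
  have [fp fr gr] := And3 (pf 1) (rf (nu 1)) (rg (nu 1)).
  rewrite vertex_adj_sym in gr; have fr1 := rf 1; rewrite vertex_adj_sym in fr1.
  have fp1 := pf (nu 1); rewrite vertex_adj_sym in fp1.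
  exact: (introT and5P (And5 fp fr1 (rg 1) gr (introT and4P (And4 fr fp1 pp isT)))).
rewrite /= !inE /= /eq_op /= !xpair_eqE.
by rewrite !(inj_eq inl_inj) !xpair_eqE !eqr_opp [1 == _]eq_sym (negbTE n11) !andbF.
Qed.

Definition theta_deleted_graph : sgraph :=
  @SGraph gvertex (relpre val vertex_adj)
    (fun v w => vertex_adj_sym (val v) (val w))
    (fun v => vertex_adj_irrefl (valP v)).

Lemma theta_deleted_graph_kg : kg_graph #|F|.+1 7 theta_deleted_graph.
Proof.
split; first exact: card_neighbours.
split; last by move=> c [c3]; apply: gvertex_ucycle_ge7.
by have [c [c7 cyc]] := gvertex_7cycle; exists c; rewrite /is_cycle c7.
Qed.

End Matching.

End Geometry.

(** * The field of order 11 *)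

(* Nonzero squares are multiplied by -4 and nonsquares by its inverse -3; as 4 is
   a square and -1 is not, this is an involution. *)
Definition nu11 (x : 'F_11) : 'F_11 := - x * (if x ^+ 5 == 1 then 4%:R else 3%:R).

(** An explicit list of residues turns the conditions on [nu11] into a computation. *)
Lemma F11_all (P : pred 'F_11) : all P [seq inZp k | k <- iota 0 11] -> forall x, P x.
Proof.
move=> /allP PP x; apply: PP; apply/mapP; exists (val x); last by rewrite valZpK.
by rewrite mem_iota; have := ltn_ord x.
Qed.

Lemma exists_kg_graph_12_7 : exists G : sgraph, kg_graph 12 7 G /\ (#|G| <= 2890)%N.
Proof.
have two0 : 2%:R != 0 :> 'F_11 by [].
have n0 : nu11 0 = 0 by apply/eqP.
have nK : involutive nu11 by move=> x; apply/eqP; move: x; apply: F11_all; vm_compute.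
have n1 (x : 'F_11) : x != 0 -> nu11 x != x.
  by apply/implyP; move: x; apply: F11_all; vm_compute.
have n2 (x : 'F_11) : x != 0 -> nu11 x != - x.
  by apply/implyP; move: x; apply: F11_all; vm_compute.
(* The left side is - 16 x for a square x and - 9 x for a nonsquare, and neither 16 nor 9 is 1
   modulo 11. *)
have n3 (x : 'F_11) : x != 0 -> nu11 (- nu11 x) != - x.
  by apply/implyP; move: x; apply: F11_all; vm_compute.
have F11 : #|'F_11| = 11 by rewrite card_Fp.
exists (theta_deleted_graph two0 nK n1); split.
  by have := theta_deleted_graph_kg two0 n0 nK n1 n2 n3; rewrite F11.
apply: leq_trans (card_gvertex _) _; by rewrite F11.
Qed.

(* Passage to the minimum order *)
Local Close Scope ring_scope.

(** Excluded middle replaces a decision procedure, as the predicate of interest quantifies over all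
    graphs. *)
Lemma ex_minimal (P : nat -> Prop) n : P n ->
  exists m, [/\ P m, m <= n & forall k, P k -> m <= k].
Proof.
elim/ltn_ind: n => n IHn Pn.
have [[k [Pk ltkn]]|min] := classic (exists k, P k /\ k < n).
  have [m [Pm mk mmin]] := IHn k ltkn Pk.
  by exists m; split=> //; apply: leq_trans mk (ltnW ltkn).
exists n; split=> // k Pk; rewrite leqNgt; apply/negP => ltkn.
by apply: min; exists k.
Qed.

Theorem mainTheorem10 :
  (exists m : nat, is_n 12 7 m /\ m <= 2890) /\
  (exists G : sgraph, kg_graph 12 7 G /\ #|G| <= 2890).
Proof.
have [G [kgG G2890]] := exists_kg_graph_12_7; split; last by exists G.
have [|m [exm mG mmin]] := @ex_minimal (fun m => exists H, kg_graph 12 7 H /\ #|H| = m) #|G|.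
  by exists G.
exists m; split; last exact: leq_trans mG G2890.
by split=> // H kgH; apply: mmin; exists H.
Qed.
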